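(* Let $\Bbbk$ be a perfect field, let $m$ be a positive integer, and let $g,g_0,g_1,\ldots,g_{m-1}\in\Bbbk[x]$ be polynomials. Assume that $g$ is separable of degree $n$ and that $\gcd(g_i,g)=1$ for $0\le i\le m-1$. Then for any $f_0,f_1,\ldots,f_{m-1}\in\Bbbk[x]$ there exists a unique $r\in\Bbbk[x]$ of degree less than $mn$ such that $$(g_i\,r)^{(i)}\equiv f_i\pmod g,\qquad 0\le i\le m-1.$$
   Context: A polynomial is separable if it has no multiple roots in the algebraic closure of $\Bbbk$. $h^{(i)}$ denotes the $i$-th (formal) derivative of a polynomial $h$.
   Formalization: The field is additionally assumed to have characteristic 0 or at least m; otherwise the p-th formal derivative vanishes identically and the claim fails for f_p = 1 with n ≥ 1 (e.g. over F_2 with m = 3, g = x, all g_i = f_i = 1). *)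

(* Defs.v *)
From HB Require Import structures.
From mathcomp Require Import all_boot all_order all_algebra all_field.

Set Implicit Arguments.
Unset Strict Implicit.
Unset Printing Implicit Defensive.

Import GRing.Theory.
Local Open Scope ring_scope.

Definition perfect_field (k : fieldType) : Prop :=
  forall q : {poly k}, irreducible_poly q -> separable_poly q.

(* MathComp defines [separable_poly g] as coprimality of g and its derivative.
   Over any algebraically closed extension of k, in particular an algebraic
   closure, this is the absence of multiple roots. *)
Lemma separable_poly_no_multiple_root (k : fieldType) (K : closedFieldType)
    (iota : {rmorphism k -> K}) (g : {poly k}) :
  separable_poly g <->
  forall a : K, ~~ (('X - a%:P) ^+ 2 %| map_poly iota g).
Proof.
rewrite -(separable_map iota); set h := map_poly iota g; split=> [sep_h a|sq].
  by rewrite separable_nosquare // size_XsubC.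
rewrite unlock; apply/Pdiv.ClosedField.coprimepP => a.
rewrite -dvdp_XsubCl => /dvdpP[q def_h]; apply: contraNneq (sq a) => h'a.
rewrite def_h expr2 dvdp_mul // dvdp_XsubCl; move: h'a.
by rewrite def_h derivM derivXsubC mulr1 !hornerE subrr mulr0 add0r => /rootP.
Qed.

(* k has characteristic 0 or characteristic at least m, i.e. (m-1)! is nonzero
   in k.  In characteristic p the i-th formal derivative vanishes identically
   for i >= p, so without this bound existence of r fails for f_i = 1. *)
Definition char0_or_ge (k : fieldType) (m : nat) : Prop :=
  forall p : nat, p \in [pchar k] -> (m <= p)%N.

(* Main.v *)
(* The derivative (q g^j)^(i) is divisible by g for i < j, and congruent to
   j! g'^j q modulo g for i = j; the factor j! g'^j is invertible modulo g, by
   separability of g and the bound on the characteristic.  Hence r can be found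
   g-adically: its digit s_j in r = \sum_(j < m) s_j g^j, size s_j <= n, is
   determined by the j-th congruence and the previous digits. *)
Require Import Defs.
From HB Require Import structures.
From mathcomp Require Import all_boot all_order all_algebra all_field.
From mathcomp Require Import ring.

Import GRing.Theory.
Local Open Scope ring_scope.

Lemma derivn_expM (R : comNzRingType) (g q : {poly R}) (j : nat) :
  exists t, (g ^+ j * q)^`(j) = g^`() ^+ j * q *+ j`! + g * t.
Proof.
elim: j q => [|j IHj] q; first by exists 0; rewrite expr0 mulr0 addr0 mulr1n.
have -> : (g ^+ j.+1 * q)^`(j.+1)
    = (g ^+ j * (g^`() * q *+ j.+1 + g * q^`()))^`(j).
  by rewrite derivSn derivM deriv_exp exprSr /=; congr (_^`(_)); ring.
have [t ->] := IHj (g^`() * q *+ j.+1 + g * q^`()).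
exists (g^`() ^+ j * q^`() *+ j`! + t).
rewrite !mulrDr addrA mulrnDl; congr (_ + _ + _).
  by rewrite mulrnAr -mulrnA mulrA -exprSr factS.
by rewrite mulrnAr mulrCA.
Qed.

Section Field.

Variable k : fieldType.
Implicit Types (f g h q : {poly k}).

Lemma dvdp_derivn_expM g q (i j : nat) : (i < j)%N ->
  g %| (g ^+ j * q)^`(i).
Proof.
(* Only [g ^+ i] is differentiated away; the spare factor [g ^+ (j - i)] survives in the leading
   term. *)
move=> lt_ij; rewrite -(subnKC (ltnW lt_ij)) exprD -mulrA.
have [t ->] := derivn_expM _ g (g ^+ (j - i) * q) i.
rewrite dvdp_addl ?dvdp_mulr // -mulr_natr dvdp_mulr // dvdp_mull //.
by rewrite dvdp_mulr // dvdp_exp // subn_gt0.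
Qed.

Lemma fact_neq0_char0_or_ge (m j : nat) : char0_or_ge k m -> (j < m)%N ->
  j`!%:R != 0 :> k.
Proof.
move=> k_char; elim: j => [|j IHj] lt_jm; first exact: oner_neq0.
rewrite factS natrM mulf_neq0 ?IHj 1?ltnW //; apply/negP => j0.
have [p pk] := natf0_pchar (ltn0Sn j) j0.
rewrite -(dvdn_pcharf pk) in j0.
by have := leq_trans lt_jm (k_char p pk); rewrite ltnNge dvdn_leq.
Qed.

Lemma coprimep_solve g h f : g != 0 -> coprimep h g ->
  exists2 s : {poly k}, (size s < size g)%N & g %| h * s - f.
Proof.
move=> g0 /Bezout_eq1_coprimepP[[u v] /= uv1].
(* [u] inverts [h] modulo [g]; reducing modulo [g] secures the size bound. *)
exists ((u * f) %% g); first by rewrite ltn_modp.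
have -> : (u * f) %% g = u * f - (u * f) %/ g * g.
  by rewrite {2}(divp_eq (u * f) g) addrC addKr.
move: (_ %/ g) => w; rewrite -{2}(mul1r f) -uv1.
have -> : h * (u * f - w * g) - (u * h + v * g) * f = g * - (v * f + h * w).
  by ring.
exact: dvdp_mulr.
Qed.

End Field.

Section Congruences.

Variables (k : fieldType) (m n : nat) (g : {poly k}) (gs : 'I_m -> {poly k}).
Hypotheses (k_char : char0_or_ge k m) (g_sep : separable_poly g).
Hypotheses (g_deg : size g = n.+1) (g_cop : forall i, coprimep (gs i) g).

Let g_neq0 : g != 0. Proof. by rewrite -size_poly_eq0 g_deg. Qed.

Lemma coprimep_lead_factor (i : 'I_m) : coprimep (g^`() ^+ i * gs i *+ i`!) g.
Proof.
rewrite -scaler_nat coprimepZl ?(fact_neq0_char0_or_ge _ m) //.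
rewrite coprimepMl g_cop andbT coprimep_expl // coprimep_sym; move: g_sep.
by rewrite separable_poly.unlock.
Qed.

Lemma derivn_digit (i : 'I_m) (s : {poly k}) :
  exists t, (gs i * (g ^+ i * s))^`(i)
            = g^`() ^+ i * gs i *+ i`! * s + g * t.
Proof.
rewrite mulrCA; have [t ->] := derivn_expM _ g (gs i * s) i.
by exists t; rewrite mulrA mulrnAl.
Qed.

Lemma congruences_exist (fs : 'I_m -> {poly k}) (j : nat) : (j <= m)%N ->
  exists2 r : {poly k}, (size r <= j * n)%N &
    forall i : 'I_m, (i < j)%N -> g %| (gs i * r)^`(i) - fs i.
Proof.
elim: j => [|j IHj] lt_jm; first by exists 0; rewrite ?size_poly0.
have [r sz_r rP] := IHj (ltnW lt_jm); pose oj := Ordinal lt_jm.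
(* The digit [s] must supply what [r] leaves missing in the [j]-th congruence. *)
have [s] := coprimep_solve _ _ _ (fs oj - (gs oj * r)^`(j)) g_neq0
  (coprimep_lead_factor oj).
rewrite g_deg ltnS => sz_s sP.
exists (r + g ^+ j * s) => [|i].
  rewrite (leq_trans (size_polyD _ _)) // geq_max.
  rewrite (leq_trans sz_r) ?leq_mul2r ?leqnSn ?orbT //=.
  have [->|s0] := eqVneq s 0; first by rewrite mulr0 size_poly0.
  have gj0 : g ^+ j != 0 by rewrite expf_neq0.
  (* [size_exp] gives only the predecessor of the size, so positivity is needed to get
     [size (g ^+ j) = (j * n).+1]. *)
  have := size_exp g j; rewrite g_deg /= => sz_gj.
  rewrite size_mul // -(prednK (_ : 0 < size (g ^+ j))%N) ?size_poly_gt0 //.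
  by rewrite sz_gj addSn /= mulSn addnC mulnC leq_add2r.
rewrite ltnS leq_eqVlt mulrDr derivnD addrAC => /orP[/eqP ij|lt_ij]; last first.
  by rewrite dvdp_addl ?rP // mulrCA dvdp_derivn_expM.
have -> : i = oj by apply: val_inj.
have [t /= ->] := derivn_digit oj s.
rewrite addrA dvdp_addl ?dvdp_mulr // addrC.
by move: sP; rewrite opprB.
Qed.

(** Induction on the exponent: if [d = s * g ^+ j], the [j]-th condition makes [g] divide [s] times
    a factor coprime to [g], so one more power of [g] divides [d]. *)
Lemma homogeneous_dvdp (d : {poly k}) :
  (forall i : 'I_m, g %| (gs i * d)^`(i)) -> g ^+ m %| d.
Proof.
move=> dP; suff: forall j, (j <= m)%N -> g ^+ j %| d by apply.
elim=> [|j IHj] lt_jm; first by rewrite expr0 dvd1p.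
have /dvdpP[s def_d] := IHj (ltnW lt_jm); pose oj := Ordinal lt_jm.
have := dP oj; rewrite def_d (mulrC s).
have [t /= ->] := derivn_digit oj s.
rewrite (dvdp_addl _ (dvdp_mulr _ (dvdpp g))) Gauss_dvdpr.
  by rewrite exprSr dvdp_mul2l ?expf_neq0.
by rewrite coprimep_sym (coprimep_lead_factor oj).
Qed.

Lemma homogeneous_eq0 (d : {poly k}) : (size d <= m * n)%N ->
  (forall i : 'I_m, g %| (gs i * d)^`(i)) -> d = 0.
Proof.
(* A nonzero multiple of [g ^+ m] has size at least [m * n + 1]. *)
move=> sz_d /homogeneous_dvdp gm_d; apply: contraTeq gm_d => d0.
apply/negP => /(dvdp_leq d0); have := size_exp g m.
have : (0 < size (g ^+ m))%N by rewrite size_poly_gt0 expf_neq0.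
rewrite g_deg /= mulnC; case: (size _) => //= e _ ->.
by move=> /leq_trans/(_ sz_d); rewrite ltnn.
Qed.

End Congruences.

Theorem mainTheorem6 (k : fieldType) (k_perfect : perfect_field k)
    (m : nat) (m_gt0 : (0 < m)%N) (k_char : char0_or_ge k m)
    (n : nat) (g : {poly k}) (gs : 'I_m -> {poly k})
    (g_sep : separable_poly g) (g_deg : size g = n.+1)
    (g_cop : forall i : 'I_m, coprimep (gs i) g)
    (fs : 'I_m -> {poly k}) :
  exists! r : {poly k},
    (size r <= m * n)%N /\
    forall i : 'I_m, g %| (gs i * r)^`(i) - fs i.
Proof.
have [r sz_r rP] :=
  congruences_exist _ _ _ _ _ k_char g_sep g_deg g_cop fs _ (leqnn m).
exists r; split=> [|r' [sz_r' r'P]]; first by split=> // i; apply: rP.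
apply/eqP; rewrite -subr_eq0; apply/eqP.
apply: (homogeneous_eq0 _ _ _ _ _ k_char g_sep g_deg g_cop).
  by rewrite (leq_trans (size_polyD _ _)) // geq_max sz_r size_polyN.
(* Inserting [fs i] splits the derivative for [r - r'] into the difference of the two given
   congruences. *)
move=> i; rewrite mulrBr derivnB -(subrKA (fs i)) -(opprB _ (fs i)).
by rewrite dvdp_addl ?dvdpNr ?rP // opprB -opprB dvdpNr.
Qed.
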